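(* Let $\alpha,\beta\in\mathbb{C}$ with $|\alpha|=|\beta|=1$, $\phi\in\mathbb{R}$ and $\theta\in(0,2\pi)$. Let $\psi_n^{\phi;\beta,\alpha;\theta}$ be the $n$-th step state of the quantum walk on $\mathbb{Z}$ with homogeneous coin $e^{i\phi}Z_\beta e^{i\theta\sigma_1}Z_\alpha$, where $Z_\omega=\mathrm{diag}(\omega,\omega^{-1})$, and initial state $\psi_0\in\ell^2(\mathbb{Z})\otimes\ell^2(\{\pm1\})$. Then for every $n\ge1$, $x\in\mathbb{Z}$ and $z\in\{\pm1\}$, $$\psi_n^{\phi;\beta,\alpha;\theta}(x,z)=e^{in\phi}e^{n\theta}\,\mathbb{E}\left[i^{S_n}(\alpha\beta)^{x-X_n}\alpha^{Z_n-z}\psi_0(X_n,Z_n)\right],$$ where $(S_n,Z_n,X_n)$ is the process defined in the context, started from $(S_0,Z_0,X_0)=(0,z,x)$ and driven by independent $N_j\sim\mathrm{Poisson}(\theta)$, $j\ge1$.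
   Context: Quantum walk with homogeneous coin $C_0\in U(\ell^2(\{\pm1\}))$: on $\ell^2(\mathbb{Z}\times\{\pm1\})\cong\ell^2(\mathbb{Z})\otimes\ell^2(\{\pm1\})$ with orthonormal basis $e_xe_z$ and $\psi=\sum_{x,z}\psi(x,z)e_xe_z$, the walk operator is $W=SC$ with $C=I\otimes C_0$ and $Se_xe_z=e_{x+z}e_z$; $\psi_n=W\psi_{n-1}$ for $n\ge1$. Matrices are in the ordered basis $(e_1,e_{-1})$; $e^{i\theta\sigma_1}=\begin{bmatrix}\cos\theta&i\sin\theta\\ i\sin\theta&\cos\theta\end{bmatrix}$. Process: $S_0=0$, $S_n=\sum_{j=1}^nN_j\pmod4\in\{0,1,2,3\}$; $Z_0=z$, $Z_n=(-1)^{S_n}z$; $X_0=x$, $X_n=x-\sum_{j=0}^{n-1}Z_j$ for $n\ge1$. *)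

(* Defs.v *)
From mathcomp Require Import all_boot all_order all_algebra.
From mathcomp Require Import finmap spectral.
From mathcomp Require Import all_classical all_reals all_analysis.
From mathcomp Require Import complex ring.
Set Implicit Arguments.
Unset Strict Implicit.
Unset Printing Implicit Defensive.
Import Order.TTheory GRing.Theory Num.Theory.
Import numFieldNormedType.Exports.
Local Open Scope classical_set_scope.
Local Open Scope ring_scope.

Definition pm1 := seq_sub [:: 1; -1 : int].

Definition int_of_pm1 (z : pm1) : int := ssval z.
Coercion int_of_pm1 : pm1 >-> int.

(* (-1)^k z; the default value of [insubd] is never used, see [pm1_flipE]. *)
Definition pm1_flip (k : nat) (z : pm1) : pm1 := insubd z ((-1) ^+ k * (z : int)).

Lemma pm1P (z : pm1) : (z : int) = 1 \/ (z : int) = -1.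
Proof.
by have := ssvalP z; rewrite !inE => /orP[] /eqP zE; [left|right]; exact: zE.
Qed.

Lemma pm1_flipE k z : pm1_flip k z = (-1) ^+ k * (z : int) :> int.
Proof.
rewrite -[LHS]/(val (insubd _ _)) insubdK //.
by case: (pm1P z) => ->; rewrite -signr_odd; case: (odd k).
Qed.

(* Position of [z] in the ordered basis (e_1, e_{-1}). *)
Definition pm1_index (z : pm1) : 'I_2 := if (z : int) == 1 then ord0 else ord_max.

Section QuantumWalk.
Context {R : realType}.
Local Notation C := R[i].

Definition state := int -> pm1 -> C.

Definition l2_norm_sq (psi : state) : \bar R :=
  \esum_(p in [set: int * pm1]) (ComplexField.Normc.normc (psi p.1 p.2) ^+ 2)%:E.

Definition in_l2 (psi : state) : Prop := (l2_norm_sq psi < +oo)%E.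

Definition ket (x : int) (z : pm1) : state :=
  fun y w => ((y == x) && (w == z))%:R.

(* The continuous linear extension of e_x e_z |-> e_{x+z} e_z, on coefficients:
   see [qw_shift_ket] and [qw_shift_l2_norm]. *)
Definition qw_shift (psi : state) : state := fun x z => psi (x - (z : int)) z.

(* The operator I (x) C0, with [C0] given by its matrix in the basis (e_1, e_{-1}):
   see [qw_coin_ket] and [qw_coin_l2_norm]. *)
Definition qw_coin (C0 : 'M[C]_2) (psi : state) : state :=
  fun x z => \sum_(w : pm1) C0 (pm1_index z) (pm1_index w) * psi x w.

Definition qw_walk (C0 : 'M[C]_2) (psi : state) : state :=
  qw_shift (qw_coin C0 psi).

Definition qw_state (C0 : 'M[C]_2) (psi0 : state) (n : nat) : state :=
  iter n (qw_walk C0) psi0.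

Lemma qw_shift_ket x z : qw_shift (ket x z) = ket (x + (z : int)) z.
Proof.
apply/funext => y; apply/funext => w; rewrite /qw_shift /ket.
by have [->|] := eqVneq w z; rewrite ?andbF // subr_eq.
Qed.

Lemma qw_coin_ket C0 x z : qw_coin C0 (ket x z) =
  fun y v => \sum_w C0 (pm1_index w) (pm1_index z) * ket x w y v.
Proof.
apply/funext => y; apply/funext => v; rewrite /qw_coin /ket.
rewrite (bigD1 z) //= eqxx andbT big1 => [|w /negPf ->]; last first.
  by rewrite andbF mulr0.
rewrite (bigD1 v) //= eqxx andbT [X in _ = _ + X]big1 // => w.
by rewrite eq_sym => /negPf ->; rewrite andbF mulr0.
Qed.

Definition mx2 (a b c d : C) : 'M[C]_2 :=
  \matrix_(i < 2, j < 2) if i == ord0 then (if j == ord0 then a else b)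
                         else (if j == ord0 then c else d).

Definition expi (t : R) : C := (cos t +i* sin t)%C.

Definition Zmx (w : C) : 'M[C]_2 := mx2 w 0 0 w^-1.

(* e^{i theta sigma_1}, in closed form. *)
Definition exp_isigma1 (theta : R) : 'M[C]_2 :=
  mx2 (cos theta)%:C%C ('i%C * (sin theta)%:C%C)
      ('i%C * (sin theta)%:C%C) (cos theta)%:C%C.

Definition coin_mx (phi : R) (beta alpha : C) (theta : R) : 'M[C]_2 :=
  expi phi *: (Zmx beta *m exp_isigma1 theta *m Zmx alpha).

End QuantumWalk.

Arguments state R : clear implicits.

Section Isometry.
Local Open Scope sesquilinear_scope.
Context {R : realType}.
Local Notation C := R[i].

Lemma normc_sqE (x : C) :
  ((ComplexField.Normc.normc x ^+ 2)%:C%C : C) = x * (x^*)%R.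
Proof. by rewrite -normCK rmorphXn. Qed.

Lemma qw_shift_l2_norm (psi : state R) :
  l2_norm_sq (qw_shift psi) = l2_norm_sq psi.
Proof.
rewrite /l2_norm_sq /qw_shift; apply/esym.
rewrite (reindex_esum [set: int * pm1] _
  (fun p : int * pm1 => (p.1 - (p.2 : int), p.2))) //.
split => //.
- by move=> [x z] [y w] _ _ /= [] /[swap] -> /addIr ->.
- by move=> [x z] _; exists (x + int_of_pm1 z, z) => //=; rewrite addrK.
Qed.

Definition pm1_of_index (i : 'I_2) : pm1 :=
  if i == ord0 then insubd (SeqSub (mem_head 1 [:: -1 : int])) 1
  else insubd (SeqSub (mem_head 1 [:: -1 : int])) (-1).

Lemma pm1_indexK : cancel pm1_index pm1_of_index.
Proof.
move=> z; apply: val_inj; rewrite /pm1_of_index /pm1_index -[RHS]/(z : int).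
by case: (pm1P z) => -> /=; rewrite insubdK.
Qed.

Lemma pm1_of_indexK : cancel pm1_of_index pm1_index.
Proof.
by move=> [[|[|//]] hi]; apply: val_inj;
  rewrite /pm1_of_index /pm1_index /int_of_pm1 /= insubdK.
Qed.

Lemma unitary_isometry (M : 'M[C]_2) (v : 'cV[C]_2) : M \is unitarymx ->
  \sum_i (ComplexField.Normc.normc ((M *m v) i ord0) ^+ 2) =
  \sum_i (ComplexField.Normc.normc (v i ord0) ^+ 2) :> R.
Proof.
move=> uM; apply: (@complexI R); rewrite !rmorph_sum /=.
under eq_bigr do rewrite normc_sqE.
under [RHS]eq_bigr do rewrite normc_sqE.
have E (u : 'cV[C]_2) : \sum_i u i ord0 * (u i ord0)^* = (u ^t* *m u) ord0 ord0.
  by rewrite !mxE; apply: eq_bigr => i _; rewrite !mxE mulrC.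
rewrite !E trmx_mul map_mxM /= -mulmxA (mulmxA (M ^t* )).
have : M ^t* *m M = 1%:M.
  by apply: mulmx1C; apply/unitarymxP.
by move=> ->; rewrite mul1mx.
Qed.

Lemma l2_norm_sqE (psi : state R) : l2_norm_sq psi =
  \esum_(x in [set: int]) (\sum_(i < 2)
    (ComplexField.Normc.normc (psi x (pm1_of_index i)) ^+ 2))%:E.
Proof.
rewrite /l2_norm_sq.
transitivity (\esum_(k in [set: int] `*`` (fun=> [set: pm1]))
  (ComplexField.Normc.normc (psi k.1 k.2) ^+ 2)%:E).
  by congr esum; apply/seteqP; split.
rewrite -(@esum_esum _ _ _ _ _
  (fun x z => (ComplexField.Normc.normc (psi x z) ^+ 2)%:E)); last first.
  by move=> x z _ _; rewrite lee_fin sqr_ge0.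
apply: eq_esum => x _; rewrite esum_fset; [|exact: finite_finset|]; last first.
  by move=> z _; rewrite lee_fin sqr_ge0.
rewrite (fsbigE (index_enum pm1)) ?index_enum_uniq //; last first.
  by move=> i _; rewrite mem_index_enum.
rewrite (eq_bigl xpredT) => [|z]; last by rewrite in_setT.
rewrite sumEFin; congr (_%:E).
by rewrite (reindex pm1_of_index) //; exists pm1_index => ? _;
  [exact: pm1_of_indexK | exact: pm1_indexK].
Qed.

Lemma qw_coin_l2_norm (M : 'M[C]_2) (psi : state R) : M \is unitarymx ->
  l2_norm_sq (qw_coin M psi) = l2_norm_sq psi.
Proof.
move=> uM; rewrite !l2_norm_sqE; apply: eq_esum => x _; congr (_%:E).
have := unitary_isometry (\col_i psi x (pm1_of_index i)) uM.
under [RHS]eq_bigr do rewrite !mxE.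
move=> <-; apply: eq_bigr => i _; rewrite !mxE /qw_coin pm1_of_indexK.
congr (ComplexField.Normc.normc _ ^+ 2).
rewrite (reindex pm1_of_index); last first.
  by exists pm1_index => ? _; [exact: pm1_of_indexK | exact: pm1_indexK].
by apply: eq_bigr => j _; rewrite pm1_of_indexK !mxE.
Qed.

Lemma qw_walk_in_l2 (M : 'M[C]_2) (psi : state R) : M \is unitarymx ->
  in_l2 psi -> in_l2 (qw_walk M psi).
Proof. by rewrite /in_l2 /qw_walk qw_shift_l2_norm => /qw_coin_l2_norm ->. Qed.

Lemma coin_mx_unitary (phi : R) (beta alpha : C) (theta : R) :
  `|alpha| = 1 -> `|beta| = 1 ->
  coin_mx phi beta alpha theta \is unitarymx.
Proof.
have U (a b c d : C) : a * a^* + b * b^* = 1 -> c * c^* + d * d^* = 1 ->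
    a * c^* + b * d^* = 0 -> mx2 a b c d \is unitarymx.
  move=> h1 h2 h3; apply/unitarymxP/matrixP => i j.
  rewrite !mxE big_ord_recl big_ord1 !mxE /=.
  case: i => -[|[|//]] hi; case: j => -[|[|//]] hj //=.
  by rewrite -[RHS]conjC0 -h3 rmorphD !rmorphM /= !conjCK mulrC [X in _ + X]mulrC.
have UZ (w : C) : `|w| = 1 -> Zmx w \is unitarymx.
  move=> w1; rewrite /Zmx; apply: U.
  - by rewrite -normCK w1 mul0r addr0 expr1n.
  - by rewrite -!normCK normfV w1 normr0 invr1 expr1n expr0n /= add0r.
  - by rewrite conjC0 mulr0 mul0r addr0.
move=> a1 b1.
have cs : cos theta * cos theta + sin theta * sin theta = 1 :> R.
  by rewrite -!expr2 cos2Dsin2.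
have conjE (x : C) : Num.conj x = (conjc x) by [].
have UR : exp_isigma1 theta \is unitarymx.
  rewrite /exp_isigma1; apply: U; rewrite !conjE; apply/eqP;
    rewrite eq_complex /=; apply/andP; split; apply/eqP;
    first [ring | rewrite -[RHS]cs; ring].
have e1 : `|expi phi| = 1 :> C.
  by rewrite normc_def /expi cos2Dsin2 sqrtr1.
have -> : coin_mx phi beta alpha theta = (expi phi)%:M *m
    (Zmx beta *m exp_isigma1 theta *m Zmx alpha) by rewrite mul_scalar_mx.
have uphi : ((expi phi)%:M : 'M[C]_2) \is unitarymx.
  apply/unitarymxP; rewrite tr_scalar_mx map_scalar_mx -scalar_mxM.
  by rewrite -normCK e1 expr1n.
apply: (mul_unitarymx uphi); apply: (mul_unitarymx _ (UZ _ a1)).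
exact: (mul_unitarymx (UZ _ b1) UR).
Qed.

End Isometry.

Section Probability.
Context {d : measure_display} {T : measurableType d} {R : realType}.
Variable P : probability T R.

Definition mutually_independent {d' : measure_display} {T' : measurableType d'}
    {I : choiceType} (D : set I) (X : I -> {RV P >-> T'}) : Prop :=
  forall (J : {fset I}) (A : I -> set T'), [set` J] `<=` D ->
    (forall j, j \in J -> measurable (A j)) ->
    P (\bigcap_(j in [set` J]) (X j @^-1` A j)) =
    (\prod_(j <- J) P (X j @^-1` A j))%E.

(* The second argument of [poisson_prob] is unused in the library. *)
Definition poisson_distributed (theta : R) (X : {RV P >-> nat}) : Prop :=
  distribution P X =1 poisson_prob theta 0.

Definition cintegrable (Y : T -> R[i]) : Prop :=
  P.-integrable setT (EFin \o (@complex.Re R \o Y)) /\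
  P.-integrable setT (EFin \o (@complex.Im R \o Y)).

Definition cexpectation (Y : T -> R[i]) : R[i] :=
  (fine 'E_P[@complex.Re R \o Y] +i* fine 'E_P[@complex.Im R \o Y])%C.

End Probability.

Section Process.
Context {T : Type}.
Variable N : nat -> T -> nat.

Definition procS (n : nat) (t : T) : nat := (\sum_(1 <= j < n.+1) N j t) %% 4.

Definition procZ (z : pm1) (n : nat) (t : T) : pm1 := pm1_flip (procS n t) z.

Definition procX (x : int) (z : pm1) (n : nat) (t : T) : int :=
  x - \sum_(0 <= j < n) (procZ z j t : int).

End Process.

(* Main.v *)
Require Import Defs.
From mathcomp Require Import all_boot all_order all_algebra.
From mathcomp Require Import finmap.
From mathcomp Require Import all_classical all_reals all_analysis.
From mathcomp Require Import complex ring.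
Set Implicit Arguments.
Unset Strict Implicit.
Unset Printing Implicit Defensive.
Import Order.TTheory GRing.Theory Num.Theory.
Import numFieldNormedType.Exports.
Local Open Scope classical_set_scope.
Local Open Scope ring_scope.

(** The formula is the expansion of the [n]-th power of a random mixture of
operators. Let [jump k] be the operator on states that moves the walker by one
step while applying the [k]-th power of [i sigma_1] between the two diagonal
phases: it flips the spin [k] times and contributes the factor [i^k]. Expanding
[e^{i theta sigma_1}] as a power series gives
[[
  W = e^{i phi} sum_k theta^k / k! jump k = e^{i phi} e^theta E[jump N]
]]
with [N] Poisson of parameter [theta]. As [jump k] depends only on [k mod 4],
this is a mixture of four operators, weighted by the law of [N mod 4]
([qw_walkE]); only two differences of these weights matter, because
[jump (k + 2) = - jump k], and they are [e^{-theta} cos theta] and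
[e^{-theta} sin theta] ([poisson_mod4_cos], [poisson_mod4_sin]).

Expanding [W^n] by linearity gives a sum over the [n]-tuples of residues mod 4
of a product of weights and a composite of jumps ([qw_stateE]). On the
probabilistic side, the composite [jump N_1 (... (jump N_n psi_0))] evaluated
at [(x, z)] telescopes to the random variable under the expectation
([jump_pathE]). It is a function of the residues of [N_1, ..., N_n], hence
takes finitely many values, so it is integrable and its expectation is a finite
sum ([finite_valued_cexpectation]); independence factors the probability of
each tuple of residues ([prob_residues]), and the two sums agree term by term. *)

(** * The Poisson law modulo 4 *)

Lemma cvg_poisson_series (R : realType) (theta : R) (A : pred nat) :
  0 < theta ->
  series (fun m => (A m)%:R * poisson_pmf theta m) @ \oo -->
    fine (poisson_prob theta 0 [set m | A m]).
Proof.
move=> theta_gt0.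
have probE : poisson_prob theta 0 [set m | A m] =
    (\sum_(0 <= m <oo) ((A m)%:R * poisson_pmf theta m)%:E)%E.
  rewrite /poisson_prob theta_gt0 -nneseries_esum; last first.
    by move=> m _; rewrite lee_fin poisson_pmf_ge0.
  rewrite eseries_mkcond; apply: eq_eseriesr => m _.
  by case: (A m); rewrite ?mul1r ?mul0r.
have prob_fin : poisson_prob theta 0 [set m | A m] \is a fin_num.
  exact: (fin_num_measure (poisson_prob theta 0)).
rewrite [X in X @ _ --> _](_ : _ = fine \o (fun n =>
    (\sum_(0 <= m < n) ((A m)%:R * poisson_pmf theta m)%:E)%E)); last first.
  by apply/funext => n; rewrite /series /= sumEFin.
apply: fine_cvg; rewrite fineK // probE.
apply: is_cvg_nneseries => m _ _.
by rewrite lee_fin mulr_ge0 ?poisson_pmf_ge0.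
Qed.

Definition poisson_mod4 (R : realType) (theta : R) (k : nat) : R :=
  fine (poisson_prob theta 0 [set m | (m %% 4)%N == k]).

(** Pairs of residues are compared because the cosine and sine series have the
signs [+, -] on the residues [0, 2] and [1, 3] respectively. *)
Lemma lim_poisson_mod4B (R : realType) (theta : R) (k l : nat)
    (c : R^nat) (s : R) :
  0 < theta ->
  (forall m, c m = expR theta *
     (((m %% 4)%N == k)%:R - ((m %% 4)%N == l)%:R) * poisson_pmf theta m) ->
  series c @ \oo --> s ->
  expR theta * (poisson_mod4 theta k - poisson_mod4 theta l) = s.
Proof.
move=> theta_gt0 cE cs; rewrite -(cvg_lim (@Rhausdorff R) cs); symmetry.
apply: (cvg_lim (@Rhausdorff R)).
rewrite (_ : series c = fun n => expR theta *
   (series (fun m => ((m %% 4)%N == k)%:R * poisson_pmf theta m) n -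
    series (fun m => ((m %% 4)%N == l)%:R * poisson_pmf theta m) n)).
  apply: cvgM; first exact: cvg_cst.
  apply: cvgB.
    exact: (@cvg_poisson_series _ _ (fun m => (m %% 4)%N == k)).
  exact: (@cvg_poisson_series _ _ (fun m => (m %% 4)%N == l)).
apply/funext => n; rewrite /series /= -sumrB mulr_sumr.
by apply: eq_bigr => m _; rewrite cE; ring.
Qed.

Lemma poisson_pmf_expR (R : realType) (theta : R) m : 0 < theta ->
  expR theta * poisson_pmf theta m = theta ^+ m / m`!%:R.
Proof.
by move=> t0; rewrite /poisson_pmf t0 mulrCA -expRD addrN expR0 mulr1.
Qed.

Lemma odd_mod4 m : odd (m %% 4) = odd m.
Proof. by rewrite [in RHS](divn_eq m 4) oddD oddM andbF. Qed.

Lemma odd_half_mod4 m : odd (m %% 4)./2 = odd m./2.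
Proof.
have mE : m = ((m %/ 4).*2.*2 + m %% 4)%N.
  by rewrite [in LHS](divn_eq m 4) -!muln2 -mulnA.
by rewrite [in RHS]mE halfD !odd_double add0n doubleK oddD odd_double.
Qed.

Lemma poisson_mod4_cos (R : realType) (theta : R) : 0 < theta ->
  expR theta * (poisson_mod4 theta 0 - poisson_mod4 theta 2) = cos theta.
Proof.
move=> theta_gt0; apply: (@lim_poisson_mod4B _ _ _ _ (cos_coeff theta)) => //.
  move=> m; rewrite mulrAC poisson_pmf_expR // /cos_coeff /= -mulrA mulrC.
  congr (_ * _); rewrite -exprnP -signr_odd -odd_half_mod4 -odd_mod4.
  have : (m %% 4 < 4)%N by rewrite ltn_mod.
  by case: (m %% 4)%N => [|[|[|[|]]]] //= _; ring.
rewrite cos.unlock; exact: is_cvg_series_cos_coeff.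
Qed.

Lemma poisson_mod4_sin (R : realType) (theta : R) : 0 < theta ->
  expR theta * (poisson_mod4 theta 1 - poisson_mod4 theta 3) = sin theta.
Proof.
move=> theta_gt0; apply: (@lim_poisson_mod4B _ _ _ _ (sin_coeff theta)) => //.
  move=> m; rewrite mulrAC poisson_pmf_expR // /sin_coeff /= -mulrA mulrC.
  congr (_ * _).
  have -> : (odd m)%:R * (-1) ^+ m.-1./2 = (odd m)%:R * (-1) ^+ m./2 :> R.
    case: m => // m /=; case: (boolP (odd m)) => [_|/negPf m_even].
      by rewrite !mul0r.
    by rewrite uphalf_half m_even.
  rewrite -signr_odd -odd_half_mod4 -odd_mod4.
  have : (m %% 4 < 4)%N by rewrite ltn_mod.
  by case: (m %% 4)%N => [|[|[|[|]]]] //= _; ring.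
rewrite sin.unlock; exact: is_cvg_series_sin_coeff.
Qed.

(** * Spin flips and powers of the imaginary unit *)

Lemma int_of_pm1_inj : injective int_of_pm1.
Proof. exact: val_inj. Qed.

Lemma pm1_flip0 z : pm1_flip 0 z = z.
Proof. by apply: int_of_pm1_inj; rewrite pm1_flipE mul1r. Qed.

Lemma pm1_flipD k l z : pm1_flip l (pm1_flip k z) = pm1_flip (k + l) z.
Proof.
by apply: int_of_pm1_inj; rewrite !pm1_flipE exprD mulrCA mulrA.
Qed.

Lemma pm1_flip_mod4 k z : pm1_flip (k %% 4) z = pm1_flip k z.
Proof.
apply: int_of_pm1_inj; rewrite !pm1_flipE.
by rewrite -signr_odd odd_mod4 signr_odd.
Qed.

Lemma eq_pm1_flip1 z : (z == pm1_flip 1 z) = false.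
Proof.
rewrite -(inj_eq int_of_pm1_inj) pm1_flipE.
by case: (pm1P z) => ->.
Qed.

Lemma big_pm1 (V : nmodType) (F : pm1 -> V) z :
  \sum_w F w = F z + F (pm1_flip 1 z).
Proof.
rewrite (bigD1 z) // (bigD1 (pm1_flip 1 z)) /=; last first.
  by rewrite eq_sym eq_pm1_flip1.
rewrite big1 ?addr0 // => w.
rewrite -!(inj_eq int_of_pm1_inj) pm1_flipE.
by case: (pm1P z) => ->; case: (pm1P w) => ->.
Qed.

Lemma exp_i_mod4 (R : rcfType) k : ('i%C : R[i]) ^+ (k %% 4) = 'i%C ^+ k.
Proof.
rewrite [in RHS](divn_eq k 4) exprD mulnC exprM (exprM _ 2 2) sqr_i.
by rewrite sqrrN !expr1n mul1r.
Qed.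

Lemma expiM (R : realType) n (phi : R) : expi (n%:R * phi) = expi phi ^+ n.
Proof.
elim: n => [|n IHn]; first by rewrite mul0r /expi cos0 sin0 expr0.
rewrite exprS -IHn -natr1 mulrDl mul1r addrC /expi cosD sinD.
by apply/eqP; rewrite eq_complex /= (addrC (sin phi * _)) !eqxx.
Qed.

(** * The walk as a mixture of jumps *)

Section Walk.
Context {R : realType}.
Local Notation C := R[i].
Variables (alpha beta : C) (phi theta : R).

(** One step of the walk with coin [Z_beta (i sigma_1)^k Z_alpha]. *)
Definition jump (k : nat) (psi : state R) : state R := fun x z =>
  'i%C ^+ k * beta ^ (z : int) * alpha ^ (pm1_flip k z : int) *
  psi (x - (z : int)) (pm1_flip k z).

Lemma jump_mod4 k psi : jump (k %% 4) psi = jump k psi.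
Proof.
by apply/funext => x; apply/funext => z; rewrite /jump pm1_flip_mod4 exp_i_mod4.
Qed.

(** Because [(i sigma_1)^2 = -1]. *)
Lemma jumpSS k psi x z : jump k.+2 psi x z = - jump k psi x z.
Proof.
rewrite /jump (_ : pm1_flip k.+2 z = pm1_flip k z); last first.
  apply: int_of_pm1_inj; rewrite !pm1_flipE.
  by rewrite -signr_odd /= negbK signr_odd.
by rewrite -addn2 exprD sqr_i; ring.
Qed.

Lemma coin_mxE z w : coin_mx phi beta alpha theta (pm1_index z) (pm1_index w) =
  expi phi * (beta ^ (z : int) *
    (if z == w then (cos theta)%:C%C else 'i%C * (sin theta)%:C%C) *
    alpha ^ (w : int)).
Proof.
rewrite -(inj_eq int_of_pm1_inj).
rewrite /coin_mx /Zmx /exp_isigma1 !mxE !big_ord_recl !big_ord0 /=.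
rewrite !mxE !big_ord_recl !big_ord0 /= !mxE /pm1_index.
by case: (pm1P z) => ->; case: (pm1P w) => -> /=; congr (_ * _);
  rewrite ?expr1z -?invr_expz ?expr1z; ring.
Qed.

(** The weights of [jump 0] and [jump 2] combine into the diagonal entries
[cos theta] of the coin, those of [jump 1] and [jump 3] into the off-diagonal
entries [i sin theta]. *)
Lemma qw_walkE psi x z : 0 < theta ->
  qw_walk (coin_mx phi beta alpha theta) psi x z =
  expi phi * \sum_(k < 4) (expR theta * poisson_mod4 theta k)%:C%C *
                            jump k psi x z.
Proof.
move=> theta_gt0; rewrite /qw_walk /qw_shift /qw_coin (big_pm1 _ z).
rewrite !coin_mxE eqxx eq_pm1_flip1 -poisson_mod4_cos // -poisson_mod4_sin //.
rewrite !big_ord_recl big_ord0 /= /bump /= !jumpSS /jump pm1_flip0.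
rewrite !mulrBr !rmorphB /=; ring.
Qed.

Lemma qw_stateE n psi x z : 0 < theta ->
  qw_state (coin_mx phi beta alpha theta) psi n x z =
  expi phi ^+ n * \sum_(v : n.-tuple 'I_4)
    (\prod_(k <- v) (expR theta * poisson_mod4 theta k)%:C%C) *
    foldr (fun k : 'I_4 => jump k) psi v x z.
Proof.
move=> theta_gt0; elim: n x z => [|n IHn] x z.
  rewrite expr0 mul1r (big_pred1 [tuple]) /=; last first.
    by move=> v; apply/esym/eqP; exact: tuple0.
  by rewrite big_nil mul1r.
rewrite [LHS]/= qw_walkE // exprS -mulrA; congr (_ * _).
(* The first entry of the tuple is the outermost of the [n + 1] steps. *)
rewrite (reindex (fun p : 'I_4 * n.-tuple 'I_4 => [tuple of p.1 :: p.2])) /=;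
    last first.
  exists (fun v => (thead v, [tuple of behead v])) => [[k v] _ | v _] /=.
    by congr pair; apply: val_inj.
  by rewrite [RHS]tuple_eta.
rewrite -(pair_bigA _ (fun k (v : n.-tuple 'I_4) =>
  (\prod_(j <- k :: v) (expR theta * poisson_mod4 theta j)%:C%C) *
  jump k (foldr (fun k : 'I_4 => jump k) psi v) x z)) /=.
rewrite mulr_sumr; apply: eq_bigr => k _.
rewrite {1}/jump IHn !mulr_sumr; apply: eq_bigr => v _.
rewrite big_cons /jump; ring.
Qed.

(** * The random path as a composite of jumps *)

Section Path.
Context {T : Type}.
Variables (N : nat -> T -> nat) (x : int) (z : pm1) (t : T).

Lemma procZ0 : procZ N z 0 t = z.
Proof. by rewrite /procZ /procS big_geq // pm1_flip0. Qed.

Lemma procZS n : procZ N z n.+1 t = pm1_flip (N n.+1 t) (procZ N z n t).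
Proof. by rewrite /procZ /procS big_nat_recr //= !pm1_flip_mod4 pm1_flipD. Qed.

Lemma exp_i_procSS n :
  'i%C ^+ procS N n.+1 t = 'i%C ^+ procS N n t * 'i%C ^+ N n.+1 t :> C.
Proof. by rewrite /procS big_nat_recr //= !exp_i_mod4 exprD. Qed.

Lemma procXS n : procX N x z n.+1 t = procX N x z n t - (procZ N z n t : int).
Proof. by rewrite /procX big_nat_recr //= opprD addrA. Qed.

Hypotheses (alpha_neq0 : alpha != 0) (beta_neq0 : beta != 0).

(** The [j]-th jump contributes the phase [beta^{Z_{j-1}} alpha^{Z_j}], and
[sum_{j < n} Z_j = x - X_n]. The induction peels off the innermost jump, which
acts at time [n + 1] from the position [(X_n, Z_n)]; hence [psi] varies. *)
Lemma jump_pathE n psi :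
  'i%C ^+ procS N n t * (alpha * beta) ^ (x - procX N x z n t) *
    alpha ^ ((procZ N z n t : int) - (z : int)) *
    psi (procX N x z n t) (procZ N z n t) =
  foldr jump psi [seq N j t | j <- iota 1 n] x z.
Proof.
elim: n psi => [|n IHn] psi.
  rewrite procZ0 /procS /procX !big_geq // subr0 !subrr /= !expr0z.
  by rewrite !mul1r.
rewrite -addn1 iotaD map_cat foldr_cat /= add1n addn1 -IHn.
rewrite exp_i_procSS procXS procZS /jump.
set X := procX N x z n t; set Z := procZ N z n t.
set Z' := pm1_flip _ Z.
have ab_neq0 : alpha * beta != 0 by rewrite mulf_neq0.
have -> : x - (X - (Z : int)) = (x - X) + (Z : int) by ring.
have -> : (Z' : int) - (z : int) =
    ((Z : int) - (z : int)) + ((Z' : int) - (Z : int)) by ring.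
rewrite (expfzDr (x - X) _ ab_neq0) (expfzDr ((Z : int) - _) _ alpha_neq0).
rewrite (expfzDr (Z' : int) _ alpha_neq0) (expfzMl alpha beta Z) -invr_expz.
have := expfz_neq0 Z alpha_neq0.
set a := alpha ^ (Z : int) => a_neq0.
by field.
Qed.

End Path.
End Walk.

(** * Expectation of a random variable with finitely many values *)

Section FiniteValued.
Context {d : measure_display} {T : measurableType d} {R : realType}.
Variable P : probability T R.
Context {F : finType} (U : T -> F).
Hypothesis mU : forall f, measurable (U @^-1` [set f]).

Lemma finite_valued_expectation (h : F -> R) :
  P.-integrable setT (EFin \o (h \o U)) /\
  ('E_P[h \o U])%E = (\sum_f h f * fine (P (U @^-1` [set f])))%:E.
Proof.
pose g f t := ((h f)%:E * (\1_(U @^-1` [set f]) t)%:E)%E.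
have hU : EFin \o (h \o U) = fun t => (\sum_f g f t)%E.
  apply/funext => t; rewrite /g /= (bigD1 (U t)) //= big1 => [|f fU].
    by rewrite adde0 indicE mem_set // mule1.
  by rewrite indicE memNset ?mule0 //= => /esym /eqP; rewrite (negPf fU).
have int_g f : P.-integrable setT (g f).
  by apply: integrableZl => //; exact: integrable_indic.
split; first by rewrite hU; exact: integrable_sum.
rewrite unlock (_ : (fun _ => _) = fun t => (\sum_f g f t)%E) //.
rewrite integral_sum // -sumEFin; apply: eq_bigr => f _.
rewrite integralZl //; last exact: integrable_indic.
by rewrite integral_indic // setIT EFinM fineK // fin_num_measure.
Qed.

Lemma finite_valued_cexpectation (h : F -> R[i]) :
  cintegrable P (h \o U) /\
  cexpectation P (h \o U) = \sum_f (fine (P (U @^-1` [set f])))%:C%C * h f.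
Proof.
have [intRe ERe] := finite_valued_expectation (@complex.Re R \o h).
have [intIm EIm] := finite_valued_expectation (@complex.Im R \o h).
split; first by split.
rewrite /cexpectation -[_ \o (h \o U)]/((@complex.Re R \o h) \o U) ERe.
rewrite -[X in ('E_P[X])%E]/((@complex.Im R \o h) \o U) EIm /=.
rewrite [LHS]complexE /= !rmorph_sum mulr_sumr -big_split.
apply: eq_bigr => f _ /=; rewrite [h f in RHS]complexE !rmorphM /=; ring.
Qed.

End FiniteValued.

(** * The joint law of the residues *)

Section Residues.
Context {d : measure_display} {T : measurableType d} {R : realType}.
Variable P : probability T R.
Variables (theta : R) (N : nat -> {RV P >-> nat}).

Definition residues (n : nat) (t : T) : n.-tuple 'I_4 :=
  [tuple inord (N i.+1 t %% 4) | i < n].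

Lemma foldr_jump_residues (alpha beta : R[i]) (psi : state R) n t :
  foldr (jump alpha beta) psi [seq N j t | j <- iota 1 n] =
  foldr (fun k : 'I_4 => jump alpha beta k) psi (residues n t).
Proof.
have -> : val (residues n t) = [seq inord (N j t %% 4) | j <- iota 1 n].
  by rewrite /residues /= (iotaDl 1 0) -val_enum_ord -!map_comp.
elim: (iota 1 n) => //= j s ->.
by rewrite inordK ?ltn_mod // jump_mod4.
Qed.

Lemma set_fset_iota n :
  [set` seq_fset tt (iota 1 n)] = [set j | (0 < j <= n)%N].
Proof.
by apply/funext => j; rewrite /mkset seq_fsetE mem_iota add1n ltnS.
Qed.

(** Written as an intersection of events indexed by a finite set of times, the
form to which independence applies; entry [i] of the tuple is time [i + 1]. *)
Lemma residues_preimage n (v : n.-tuple 'I_4) :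
  residues n @^-1` [set v] =
  \bigcap_(j in [set` seq_fset tt (iota 1 n)])
    (N j @^-1` [set m | (m %% 4)%N == nth ord0 v j.-1]).
Proof.
rewrite set_fset_iota; apply/seteqP; split => t /=.
  move=> vE [|j] //= jn.
  by rewrite -vE -(tnth_nth _ _ (Ordinal jn)) tnth_mktuple inordK ?ltn_mod.
move=> Nv; apply: eq_from_tnth => i; rewrite tnth_mktuple; apply: val_inj.
have /= /eqP Ni := Nv i.+1 (ltn_ord i).
by rewrite inordK ?ltn_mod // Ni (tnth_nth ord0).
Qed.

Lemma measurable_residues n (v : n.-tuple 'I_4) :
  measurable (residues n @^-1` [set v]).
Proof.
rewrite residues_preimage; apply: fin_bigcap_measurable => // j _.
by apply: measurable_funPTI.
Qed.

Lemma prob_residues n (v : n.-tuple 'I_4) :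
  (forall j, (1 <= j)%N -> poisson_distributed theta (N j)) ->
  mutually_independent [set j | (1 <= j)%N] N ->
  fine (P (residues n @^-1` [set v])) = \prod_(k <- v) poisson_mod4 theta k.
Proof.
move=> NP indep; rewrite residues_preimage indep; first last.
- by [].
- by rewrite set_fset_iota => j /andP[].
rewrite (perm_big _ (seq_fset_perm _ _)) undup_id ?iota_uniq //.
rewrite (iotaDl 1 0) big_map.
transitivity (fine (\prod_(k <- v) (poisson_mod4 theta k)%:E)%E); last first.
  by rewrite prodEFin.
congr fine; rewrite (big_nth ord0) size_tuple /index_iota subn0 !big_seq.
apply: eq_bigr => i; rewrite mem_iota => /andP[_ i_n]; rewrite add1n /=.
rewrite -[P _]/(distribution P (N i.+1) _) NP // /poisson_mod4 fineK //.
exact: (fin_num_measure (poisson_prob theta 0)).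
Qed.

End Residues.

(** * The Feynman-Kac formula *)

Theorem theorem5p1 (R : realType) (d : measure_display) (T : measurableType d)
    (P : probability T R) (alpha beta : R[i]) (phi theta : R)
    (psi0 : state R) (N : nat -> {RV P >-> nat}) :
  `|alpha| = 1 -> `|beta| = 1 -> 0 < theta -> theta < 2 * pi ->
  in_l2 psi0 ->
  (forall j, (1 <= j)%N -> poisson_distributed theta (N j)) ->
  mutually_independent [set j | (1 <= j)%N] N ->
  forall (n : nat) (x : int) (z : pm1), (1 <= n)%N ->
    let S := procS (fun j => N j) n in
    let Z := procZ (fun j => N j) z n in
    let X := procX (fun j => N j) x z n in
    let Y := fun t => 'i%C ^+ S t * (alpha * beta) ^ (x - X t) *
                      alpha ^ ((Z t : int) - (z : int)) * psi0 (X t) (Z t) in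
    cintegrable P Y /\
    qw_state (coin_mx phi beta alpha theta) psi0 n x z =
      expi (n%:R * phi) * (expR (n%:R * theta))%:C%C * cexpectation P Y.
Proof.
move=> alpha1 beta1 theta_gt0 _ _ NP indep n x z _ S Z X Y.
have alpha_neq0 : alpha != 0 by rewrite -normr_eq0 alpha1 oner_neq0.
have beta_neq0 : beta != 0 by rewrite -normr_eq0 beta1 oner_neq0.
pose h (v : n.-tuple 'I_4) :=
  foldr (fun k : 'I_4 => jump alpha beta k) psi0 v x z.
have -> : Y = h \o residues N n.
  apply/funext => t; rewrite /Y /S /X /Z jump_pathE //.
  by rewrite foldr_jump_residues.
have [intY ->] := finite_valued_cexpectation P (measurable_residues N (n:=n)) h.
split => //; rewrite qw_stateE // expiM -mulrA; congr (_ * _).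
rewrite mulr_sumr; apply: eq_bigr => v _.
rewrite (prob_residues v NP indep) mulrA; congr (_ * _).
under eq_bigr do rewrite rmorphM.
rewrite big_split /= big_const_seq count_predT size_tuple iter_mulr_1.
by rewrite expRM_natl rmorphXn rmorph_prod.
Qed.
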